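(* Let $\{X_j\}_{j=1}^\infty$ be a sequence of darts taking values in $\mathbb{R}^n$ which converges in distribution to some dart $X$. (i) For any $f\in C_0(\mathbb{R}^n)$ and $d>0$, $\lim_{j\to\infty} g_{X_j,f}(d)=g_{X,f}(d)$. As a consequence, for any $f\in C_0(\mathbb{R}^n)$ for which $(X_j,f)$ is reasonable for all $j$, $(X,f)$ is reasonable. (ii) The first statement in (i) is false if $C_0(\mathbb{R}^n)$ is replaced by $C_b(\mathbb{R}^n)$; that is, there exist darts $X_j$ and $X$ in $\mathbb{R}^n$ with $X_j\to X$ in distribution, a function $f\in C_b(\mathbb{R}^n)$ and $d>0$ such that $g_{X_j,f}(d)$ does not converge to $g_{X,f}(d)$. (iii) If, in addition, $X_j$ approaches $X$ in total variation, then (i) is still true with $C_0(\mathbb{R}^n)$ replaced by $C_b(\mathbb{R}^n)$; that is, for any $f\in C_b(\mathbb{R}^n)$ and $d>0$, $\lim_{j\to\infty} g_{X_j,f}(d)=g_{X,f}(d)$, and consequently if $f\in C_b(\mathbb{R}^n)$ and $(X_j,f)$ is reasonable for all $j$, then $(X,f)$ is reasonable. (iv) If each $X_j$ is reasonable with respect to $C_b(\mathbb{R}^n)$, then $X$ is reasonable with respect to $C_b(\mathbb{R}^n)$.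
   Context: A dart is a random vector $X$ taking values in $\mathbb{R}^n$. A payoff function is a measurable function $f:\mathbb{R}^n\to\mathbb{R}$ bounded from above. For $d>0$, $g_{X,f}(d):=\sup_{a\in\mathbb{R}^n}Ef(a+dX)$. The pair $(X,f)$ is reasonable if $g_{X,f}(d)$ is decreasing (i.e. non-increasing) in $d\in(0,\infty)$. $X$ is reasonable with respect to a family $\mathcal{F}$ of payoff functions if $(X,f)$ is reasonable for all $f\in\mathcal{F}$. $C_0(\mathbb{R}^n)$ is the set of continuous $f:\mathbb{R}^n\to\mathbb{R}$ with $\lim_{\|x\|\to\infty}f(x)=0$; $C_b(\mathbb{R}^n)$ is the set of bounded continuous $f:\mathbb{R}^n\to\mathbb{R}$. Convergence in total variation means that the laws converge in total variation distance. *)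

(* Defs.v *)
From HB Require Import structures.
From mathcomp Require Import all_boot all_order all_algebra.
From mathcomp Require Import all_classical all_reals all_analysis.
From mathcomp Require Import measurable_realfun.

Set Implicit Arguments.
Unset Strict Implicit.
Unset Printing Implicit Defensive.

Import Order.TTheory GRing.Theory Num.Theory.
Import numFieldNormedType.Exports.

Local Open Scope classical_set_scope.
Local Open Scope ring_scope.

(* The Borel sigma-algebra on R^n. *)
HB.instance Definition _ (R : realType) (n : nat) :=
  @isMeasurable.Build (sigma_display (@open 'rV[R]_n)) 'rV[R]_n
    <<s @open 'rV[R]_n >> (@sigma_algebra0 _ setT _) (@sigma_algebraC _ _)
    (@sigma_algebra_bigcup _ setT _).

(* Each dart carries its own probability space, so the members of a sequence
   of darts need not be defined on a common one. *)
Record dart (R : realType) (n : nat) := Dart {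
  dart_display : measure_display;
  dart_space : measurableType dart_display;
  dart_prob : probability dart_space R;
  dart_rv : {RV dart_prob >-> 'rV[R]_n} }.

Definition dart_fun (R : realType) (n : nat) (X : dart R n) :
  dart_space X -> 'rV[R]_n := dart_rv X.

Coercion dart_fun : dart >-> Funclass.

Section darts.
Context {R : realType} {n : nat}.
Implicit Types (X Y : dart R n) (f : 'rV[R]_n -> R) (F : set ('rV[R]_n -> R)).

Definition law X : set 'rV[R]_n -> \bar R :=
  distribution (dart_prob X) (dart_rv X).

Definition payoff : set ('rV[R]_n -> R) :=
  [set f : 'rV[R]_n -> R | measurable_fun [set: 'rV[R]_n] f /\
    exists M, forall x, f x <= M].

(* For a payoff function the positive part of the integrand is bounded, so the
   expectation is a well-defined element of [-oo, +oo[. *)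
Definition gain X f (d : R) : \bar R :=
  ereal_sup [set ('E_(dart_prob X)[fun w => f (a + d *: X w)%R])%E
            | a in [set: 'rV[R]_n]].

Definition reasonable X f : Prop :=
  forall d1 d2 : R, 0 < d1 -> d1 <= d2 -> (gain X f d2 <= gain X f d1)%E.

(* Meant for families F of payoff functions; Cb_payoff below covers Cb. *)
Definition reasonable_wrt X F : Prop := forall f, F f -> reasonable X f.

Definition Cb : set ('rV[R]_n -> R) :=
  [set f : 'rV[R]_n -> R | continuous f /\ exists M, forall x, `|f x| <= M].

(* The library's norm on 'rV[R]_n is the sup norm; as all norms on R^n are
   equivalent, the limit at infinity does not depend on this choice. *)
Definition C0 : set ('rV[R]_n -> R) :=
  [set f : 'rV[R]_n -> R | continuous f /\
    forall e, 0 < e -> exists M, forall x, M < `|x| -> `|f x| < e].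

Definition cvg_in_distribution (X_ : nat -> dart R n) X : Prop :=
  forall h, Cb h ->
    ('E_(dart_prob (X_ j))[fun w => h (X_ j w)])%E @[j --> \oo] -->
    ('E_(dart_prob X)[fun w => h (X w)])%E.

Definition tv_distance X Y : \bar R :=
  ereal_sup [set `|law X A - law Y A|%E | A in measurable].

Definition cvg_in_total_variation (X_ : nat -> dart R n) X : Prop :=
  tv_distance (X_ j) X @[j --> \oo] --> 0%E.

Lemma Cb_payoff : Cb `<=` payoff.
Proof.
move=> f [/continuousP fc [M fM]]; split; last first.
  by exists M => x; exact: le_trans (ler_norm _) (fM x).
apply: (measurability _ (RGenOpens.measurableE R)).
move=> _ [_ [a [b ->] <-]]; rewrite setTI.
by apply: sub_sigma_algebra; exact/fc/interval_open.
Qed.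

End darts.

Arguments Cb R n : clear implicits.
Arguments C0 R n : clear implicits.
Arguments payoff R n : clear implicits.

(* Main.v *)
From HB Require Import structures.
Require Import Defs.
From mathcomp Require Import all_boot all_order all_algebra.
From mathcomp Require Import all_classical all_reals all_analysis.
From mathcomp Require Import measurable_realfun ring lra.

Import Order.TTheory GRing.Theory Num.Theory.
Import numFieldNormedType.Exports.

Local Open Scope classical_set_scope.
Local Open Scope ring_scope.

(** The gain is a supremum over the aiming point a of E f(a + dX), so it
    converges along a sequence of darts as soon as these expectations converge
    uniformly in a ([gain_cvg]); reasonableness then passes to the limit, being
    a family of non-strict inequalities between gains ([reasonable_lim]).

    For f vanishing at infinity, uniformity comes from two regimes
    ([C0_mean_unif_cvg]). All but a small part of the mass of X lies in a ball,
    and weak convergence, tested against a continuous cutoff of that ball, gives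
    the same for X_j with j large. Aiming points far from the origin therefore
    contribute almost nothing, whatever the dart. The remaining aiming points
    form a compact set, on which pointwise convergence becomes uniform because
    uniform continuity of f makes the expectations equicontinuous in a.

    For a merely bounded continuous f uniformity can fail. Take X in {0, 1} and
    f(t) = u(t) - u(t + 1) with u(t) = cos(pi t^2), along one coordinate: the
    sum f(a) + f(a + 1) = u(a) - u(a + 2) telescopes and is at most 2, so the
    gain of X is at most 1. If the gap 1 is replaced by 1 + s, the oscillations
    of u far from the origin are fast enough for the shift s to invert a sign,
    and the sum of the two values exceeds 2 by a fixed amount at an aiming point
    of order 1/s. The gains for s -> 0 thus stay away from the gain of X
    ([resonance_le], [gain_not_cvg]).

    Under convergence in total variation, expectations of any function bounded
    by B differ by at most 2B times the distance ([mean_tv_dist]), and this does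
    not depend on a.

    The last claim reduces to functions vanishing at infinity
    ([Cb_reasonable_lim]): adding a constant to f makes it nonnegative without
    changing reasonableness, and f is then the increasing limit of its products
    with cutoffs, for which reasonableness of X is already known. *)

(** * Expectations of bounded Borel functions *)

Definition bounded_borel {R : realType} {n : nat} (f : 'rV[R]_n -> R) : Prop :=
  measurable_fun [set: 'rV[R]_n] f /\ exists M, forall x, `|f x| <= M.

Definition mean {R : realType} {n : nat} (X : dart R n)
    (f : 'rV[R]_n -> R) : R :=
  Rintegral (dart_prob X) setT (fun w => f (X w)).

Lemma Cb_bounded_borel {R : realType} {n : nat} (f : 'rV[R]_n -> R) :
  Cb R n f -> bounded_borel f.
Proof. by move=> fCb; have [mf _] := Cb_payoff fCb; case: fCb. Qed.

Lemma bounded_borel_cst {R : realType} {n : nat} (c : R) :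
  bounded_borel (fun _ : 'rV[R]_n => c).
Proof. by split; [exact: measurable_cst | exists `|c|]. Qed.

Lemma bounded_borelD {R : realType} {n : nat} (f g : 'rV[R]_n -> R) :
  bounded_borel f -> bounded_borel g -> bounded_borel (fun x => f x + g x).
Proof.
move=> [mf [M fM]] [mg [N gN]]; split; first exact: measurable_funD.
by exists (M + N) => x; rewrite (le_trans (ler_normD _ _))// lerD.
Qed.

Lemma bounded_borelZ {R : realType} {n : nat} (c : R) (f : 'rV[R]_n -> R) :
  bounded_borel f -> bounded_borel (fun x => c * f x).
Proof.
move=> [mf [M fM]]; split; first exact: measurable_funM.
by exists (`|c| * M) => x; rewrite normrM ler_wpM2l.
Qed.

Lemma bounded_borel_sum {R : realType} {n : nat} (h : nat -> 'rV[R]_n -> R) N :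
  (forall k, bounded_borel (h k)) ->
  bounded_borel (fun x => \sum_(k < N) h k x).
Proof.
move=> bh; elim: N => [|N IH].
  by under eq_fun do rewrite big_ord0; exact: bounded_borel_cst.
by under eq_fun do rewrite big_ord_recr/=; exact: bounded_borelD.
Qed.

Lemma bounded_borel_indic {R : realType} {n : nat} (A : set 'rV[R]_n) :
  measurable A -> bounded_borel (\1_A : 'rV[R]_n -> R).
Proof.
move=> mA; split; first exact: measurable_indic.
by exists 1 => x; rewrite indicE; case: (_ \in _); rewrite ?normr1 ?normr0.
Qed.

Lemma bounded_borel_integrable {R : realType} {n : nat} (X : dart R n)
    (f : 'rV[R]_n -> R) : bounded_borel f ->
  (dart_prob X).-integrable setT (EFin \o (fun w => f (X w))).
Proof.
move=> [mf [M fM]]; apply: measurable_bounded_integrable => //.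
- by rewrite [X in (X < _)%E]probability_setT ltry.
- apply: (measurableT_comp mf); exact: measurable_funPT.
- exists M; split; rewrite ?num_real// => y My w _ /=.
  exact: le_trans (fM _) (ltW My).
Qed.

Lemma expectationE {R : realType} {n : nat} (X : dart R n) (f : 'rV[R]_n -> R) :
  bounded_borel f -> 'E_(dart_prob X)[fun w => f (X w)]%E = (mean X f)%:E.
Proof.
move=> bf; rewrite unlock /mean /Rintegral fineK//.
by apply: integrable_fin_num => //; exact: bounded_borel_integrable.
Qed.

Lemma mean_cst {R : realType} {n : nat} (X : dart R n) (c : R) :
  mean X (fun=> c) = c.
Proof.
by rewrite /mean Rintegral_cst// [X in fine X]probability_setT mulr1.
Qed.

Lemma meanD {R : realType} {n : nat} (X : dart R n) (f g : 'rV[R]_n -> R) :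
  bounded_borel f -> bounded_borel g ->
  mean X (fun x => f x + g x) = mean X f + mean X g.
Proof.
by move=> bf bg; rewrite /mean RintegralD//; exact: bounded_borel_integrable.
Qed.

Lemma meanZ {R : realType} {n : nat} (X : dart R n) (c : R)
    (f : 'rV[R]_n -> R) :
  bounded_borel f -> mean X (fun x => c * f x) = c * mean X f.
Proof.
by move=> bf; rewrite /mean RintegralZl//; exact: bounded_borel_integrable.
Qed.

Lemma mean_le {R : realType} {n : nat} (X : dart R n) (f g : 'rV[R]_n -> R) :
  bounded_borel f -> bounded_borel g -> (forall x, f x <= g x) ->
  mean X f <= mean X g.
Proof.
by move=> bf bg fg; apply: le_Rintegral => //; exact: bounded_borel_integrable.
Qed.

Lemma mean_sum {R : realType} {n : nat} (X : dart R n)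
    (h : nat -> 'rV[R]_n -> R) N : (forall k, bounded_borel (h k)) ->
  mean X (fun x => \sum_(k < N) h k x) = \sum_(k < N) mean X (h k).
Proof.
move=> bh; elim: N => [|N IH].
  by under eq_fun do rewrite big_ord0; rewrite mean_cst big_ord0.
under eq_fun do rewrite big_ord_recr/=.
by rewrite meanD ?big_ord_recr ?IH//; exact: bounded_borel_sum.
Qed.

Lemma mean_indic {R : realType} {n : nat} (X : dart R n) (A : set 'rV[R]_n) :
  measurable A -> mean X \1_A = fine (law X A).
Proof.
move=> mA; have := expectationE X _ (bounded_borel_indic _ mA).
move/(congr1 fine) => /= <-; congr fine.
rewrite -[RHS]/(dart_prob X (X @^-1` A)).
rewrite -expectation_indic; first by [].
by rewrite -[X in measurable X]setTI; exact: measurable_funPT.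
Qed.

Lemma mean_dist {R : realType} {n : nat} (X : dart R n)
    (f g : 'rV[R]_n -> R) e :
  bounded_borel f -> bounded_borel g -> (forall x, `|f x - g x| <= e) ->
  `|mean X f - mean X g| <= e.
Proof.
move=> bf bg fg; have be := bounded_borel_cst e (n := n).
rewrite ler_distl -{1 2}(mean_cst X e); apply/andP; split.
  rewrite lerBlDr -meanD//; apply: mean_le => //; first exact: bounded_borelD.
  by move=> x; apply: ler_distlDr; rewrite distrC.
rewrite -meanD//; apply: mean_le => //; first exact: bounded_borelD.
by move=> x; exact: ler_distlDr.
Qed.

(** Dominated convergence, with a constant as dominating function since the
    measure is finite. *)
Lemma mean_bounded_cvg {R : realType} {n : nat} (X : dart R n)
    (h_ : nat -> 'rV[R]_n -> R) (h : 'rV[R]_n -> R) (B : R) :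
  (forall k, bounded_borel (h_ k)) -> bounded_borel h ->
  (forall k x, `|h_ k x| <= B) -> (forall x, h_ k x @[k --> \oo] --> h x) ->
  mean X (h_ k) @[k --> \oo] --> mean X h.
Proof.
move=> bh_ bh hB hh.
have mX (g : 'rV[R]_n -> R) : bounded_borel g ->
    measurable_fun setT (EFin \o (fun w => g (X w))).
  by move=> /(bounded_borel_integrable X) /measurable_int.
have bB := bounded_borel_cst B (n := n).
have [|||||_ _] := @dominated_convergence _ _ _ (dart_prob X) setT measurableT
  (fun k w => (h_ k (X w))%:E) (fun w => (h (X w))%:E) (fun=> B%:E).
- by move=> k; exact: mX.
- exact: mX.
- by apply: aeW => w _; apply: cvg_EFin; [exact: nearW | exact: hh].
- exact: (bounded_borel_integrable X _ bB).
- by apply: aeW => w k _; rewrite lee_fin.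
rewrite -[X in _ --> X -> _]fineK.
  by move/fine_cvg.
by apply: integrable_fin_num => //; exact: bounded_borel_integrable.
Qed.

(** * The gain as a real supremum *)

(** The payoff of a dart landing at x, as a function of x, when aiming at a
    from distance d. *)
Definition throw {R : realType} {n : nat} (f : 'rV[R]_n -> R) (d : R)
  (a x : 'rV[R]_n) : R := f (a + d *: x).

(** For bounded payoffs the gain is finite ([gainE]); working with this real
    supremum keeps the estimates free of extended-real arithmetic. *)
Definition rgain {R : realType} {n : nat} (X : dart R n) (f : 'rV[R]_n -> R)
  (d : R) : R := sup [set mean X (throw f d a) | a in [set: 'rV[R]_n]].

Lemma Cb_throw {R : realType} {n : nat} (f : 'rV[R]_n -> R) (d : R) a :
  Cb R n f -> Cb R n (throw f d a).
Proof.
move=> [cf [M fM]]; split; last by exists M => x; exact: fM.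
move=> x; apply: continuous_comp; last exact: cf.
apply: continuousD; [exact: cst_continuous | exact: scaler_continuous].
Qed.

Lemma bounded_borel_throw {R : realType} {n : nat} (f : 'rV[R]_n -> R)
    (d : R) a :
  Cb R n f -> bounded_borel (throw f d a).
Proof. by move=> fCb; exact/Cb_bounded_borel/Cb_throw. Qed.

Lemma Cb_bound {R : realType} {n : nat} (f : 'rV[R]_n -> R) : Cb R n f ->
  exists2 B, 0 < B & forall x, `|f x| <= B.
Proof.
move=> [_ [B fB]]; exists (`|B| + 1); first by rewrite ltr_wpDl.
by move=> x; rewrite (le_trans (fB x))// (le_trans (ler_norm _))// lerDl.
Qed.

Lemma rgain_has_ubound {R : realType} {n : nat} (X : dart R n) f (d : R) :
  Cb R n f -> has_ubound [set mean X (throw f d a) | a in [set: 'rV[R]_n]].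
Proof.
move=> fCb; have [_ [M fM]] := fCb; exists M => _ [a _ <-].
rewrite -[leRHS](mean_cst X); apply: mean_le.
- exact: bounded_borel_throw.
- exact: bounded_borel_cst.
- by move=> x; exact: le_trans (ler_norm _) (fM _).
Qed.

Lemma mean_le_rgain {R : realType} {n : nat} (X : dart R n) f (d : R) a :
  Cb R n f -> mean X (throw f d a) <= rgain X f d.
Proof.
by move=> fCb; apply: ub_le_sup; [exact: rgain_has_ubound | exists a].
Qed.

Lemma rgain_le {R : realType} {n : nat} (X : dart R n) f (d c : R) :
  (forall a, mean X (throw f d a) <= c) -> rgain X f d <= c.
Proof.
move=> fc; apply: ge_sup; first by exists (mean X (throw f d 0)); exists 0.
by move=> _ [a _ <-].
Qed.

Lemma gainE {R : realType} {n : nat} (X : dart R n) f (d : R) :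
  Cb R n f -> gain X f d = (rgain X f d)%:E.
Proof.
move=> fCb; rewrite /rgain -ereal_sup_EFin; first 1 last.
- exact: rgain_has_ubound.
- by exists (mean X (throw f d 0)); exists 0.
rewrite /gain image_comp; congr ereal_sup; apply: eq_imagel => a _ /=.
by rewrite -(expectationE X (throw f d a)) //; exact: bounded_borel_throw.
Qed.

Lemma reasonableE {R : realType} {n : nat} (X : dart R n) f : Cb R n f ->
  reasonable X f <->
  forall d1 d2 : R, 0 < d1 -> d1 <= d2 -> rgain X f d2 <= rgain X f d1.
Proof.
by move=> fCb; split=> rX d1 d2 d10 d12; have := rX d1 d2 d10 d12;
  rewrite !gainE// lee_fin.
Qed.

(** The supremum is 1-Lipschitz for the uniform norm, so uniform convergence of
    the expectations over all aiming points is enough. *)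
Lemma gain_cvg {R : realType} {n : nat} (X_ : nat -> dart R n) (X : dart R n) f
    (d : R) : Cb R n f ->
  (forall e, 0 < e -> \forall j \near \oo, forall a,
     `|mean X (throw f d a) - mean (X_ j) (throw f d a)| <= e) ->
  gain (X_ j) f d @[j --> \oo] --> gain X f d.
Proof.
move=> fCb unif; under eq_fun do rewrite gainE//.
rewrite gainE//; apply: cvg_EFin; first exact: nearW.
apply/cvgrPdist_le => e e0; near=> j => /=.
have dist a : `|mean X (throw f d a) - mean (X_ j) (throw f d a)| <= e.
  by move: a; near: j; exact: unif.
rewrite ler_distl lerBlDr; apply/andP; split; apply: rgain_le => a.
  have distC := dist a; rewrite distrC in distC.
  by rewrite (le_trans (ler_distlDr distC))// lerD2r; exact: mean_le_rgain.
by rewrite (le_trans (ler_distlDr (dist a)))// lerD2r; exact: mean_le_rgain.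
Unshelve. all: by end_near. Qed.

Lemma reasonable_lim {R : realType} {n : nat} (X_ : nat -> dart R n)
    (X : dart R n) f :
  (forall d : R, 0 < d -> gain (X_ j) f d @[j --> \oo] --> gain X f d) ->
  (forall j, reasonable (X_ j) f) -> reasonable X f.
Proof.
move=> cvg_gain rX d1 d2 d10 d12; have d20 := lt_le_trans d10 d12.
by apply: (lee_cvg_to (cvg_gain _ d20) (cvg_gain _ d10)); apply: nearW => j;
  exact: rX.
Qed.

(** * Stability under total variation *)

(** The sum counts the natural numbers below y, so it is y rounded up. *)
Lemma staircase_bounds {R : realType} (y : R) N : 0 <= y <= N%:R ->
  y <= \sum_(k < N) (k%:R < y)%R%:R <= y + 1.
Proof.
move=> /andP[y0]; elim: N => [|N IH] yN; first by rewrite big_ord0; lra.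
have [Ny|yN'] := ltP N%:R y; last first.
  by rewrite big_ord_recr/= ltNge yN' addr0 IH.
rewrite (eq_bigr (fun=> 1)) => [|k _]; last first.
  by rewrite (le_lt_trans _ Ny)// ler_nat -ltnS.
rewrite sumr_const card_ord yN -natr1 lerD2r ltW//.
Qed.

(** A discrete layer-cake argument: g is within 1/N of the average S of the
    indicators of the superlevel sets {g > k/N}, k < N. The laws differ by at
    most t on each of these sets, hence so do the expectations of their
    average; N is arbitrary. *)
Lemma mean_tv_le {R : realType} {n : nat} (X Y : dart R n)
    (g : 'rV[R]_n -> R) t :
  bounded_borel g -> (forall x, 0 <= g x <= 1) ->
  (forall A, measurable A -> `|fine (law X A) - fine (law Y A)| <= t) ->
  mean X g <= mean Y g + t.
Proof.
move=> bg g01 tv; apply/ler_addgt0Pl => e e0.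
(* The number of steps is taken above 1/e, and nonzero. *)
have [N eN] : exists N : nat, e^-1 < N.+1%:R.
  have [N _ /(_ N (leqnn N)) h] := near_infty_natSinv_lt (PosNum e0).
  by exists N; rewrite invf_plt ?posrE.
pose A k := [set x | k%:R < N.+1%:R * g x].
have mA k : measurable (A k).
  have [mNg _] := bounded_borelZ N.+1%:R g bg.
  have -> : A k =
      [set: 'rV[R]_n] `&` (fun x => N.+1%:R * g x) @^-1` `]k%:R, +oo[.
    by rewrite setTI; apply/seteqP; split=> x /=; rewrite in_itv/= andbT.
  by apply: mNg => //; exact: measurable_itv.
pose ind k : 'rV[R]_n -> R := \1_(A k).
have bA k : bounded_borel (ind k) by exact: bounded_borel_indic.
pose S x := N.+1%:R^-1 * \sum_(k < N.+1) ind k x.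
have bS : bounded_borel S.
  by apply: bounded_borelZ; exact: (bounded_borel_sum ind).
have SE (Z : dart R n) : mean Z S =
    N.+1%:R^-1 * \sum_(k < N.+1) fine (law Z (A k)).
  rewrite meanZ; last exact: (bounded_borel_sum ind).
  rewrite (mean_sum _ ind)//; congr (_ * _).
  by apply: eq_bigr => k _; exact: mean_indic.
have Sbd x : g x <= S x <= g x + N.+1%:R^-1.
  have /andP[g0 g1] := g01 x.
  have : 0 <= N.+1%:R * g x <= N.+1%:R by rewrite mulr_ge0// ler_piMr.
  move=> /staircase_bounds.
  have sE : \sum_(k < N.+1) ind k x =
      \sum_(k < N.+1) (k%:R < N.+1%:R * g x)%R%:R.
    apply: eq_bigr => k _; rewrite /ind indicE /A; congr (_%:R).
    by congr nat_of_bool; apply/idP/idP; rewrite inE.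
  rewrite /S sE.
  set s := \sum_(k < _) _.
  rewrite [_^-1 * s]mulrC ler_pdivlMr// ler_pdivrMr// mulrDl mulVf//.
  by rewrite ![g x * _]mulrC.
have tvr k : fine (law X (A k)) <= fine (law Y (A k)) + t.
  exact: ler_distlDr (tv _ (mA k)).
have le1 : mean X g <= mean X S.
  by apply: mean_le => // x; case/andP: (Sbd x).
have le2 : mean X S <= mean Y S + t.
  have -> : mean Y S + t =
      N.+1%:R^-1 * \sum_(k < N.+1) (fine (law Y (A k)) + t).
    rewrite SE big_split/= sumr_const card_ord mulrDr; congr (_ + _).
    by rewrite -[t *+ _]mulr_natl mulrA mulVf// mul1r.
  by rewrite SE ler_pM2l ?invr_gt0//; exact: ler_sum.
have le3 : mean Y S <= mean Y g + N.+1%:R^-1.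
  rewrite -(mean_cst Y N.+1%:R^-1) -meanD//; last exact: bounded_borel_cst.
  apply: mean_le => //.
    by apply: bounded_borelD => //; exact: bounded_borel_cst.
  by move=> x; case/andP: (Sbd x).
have le4 : N.+1%:R^-1 <= e by rewrite invf_ple ?posrE// ltW.
rewrite addrC -addrA [t + e]addrC addrA (le_trans le1)// (le_trans le2)//.
by rewrite lerD2r (le_trans le3)// lerD2l.
Qed.

(** An affine map sends the range [-B, B] to [0, 1] and shrinks distances by
    2B. *)
Lemma mean_tv_dist {R : realType} {n : nat} (X Y : dart R n) (f : 'rV[R]_n -> R)
    (B t : R) : bounded_borel f -> 0 < B -> (forall x, `|f x| <= B) ->
  (forall A, measurable A -> `|fine (law X A) - fine (law Y A)| <= t) ->
  `|mean X f - mean Y f| <= 2 * B * t.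
Proof.
move=> bf B0 fB tv.
pose g x := (2 * B)^-1 * (f x + B).
have bfB : bounded_borel (fun x => f x + B).
  by apply: bounded_borelD => //; exact: bounded_borel_cst.
have bg : bounded_borel g by exact: bounded_borelZ.
have g01 x : 0 <= g x <= 1.
  have := fB x; rewrite ler_norml /g mulrC => /andP[h1 h2].
  rewrite ler_pdivlMr ?ler_pdivrMr ?mulr_gt0//; lra.
have gE (Z : dart R n) : mean Z f = 2 * B * mean Z g - B.
  rewrite meanZ// meanD//; last exact: bounded_borel_cst.
  by rewrite mean_cst mulrA divff ?mulf_neq0 ?gt_eqF// mul1r addrK.
have tv' A : measurable A -> `|fine (law Y A) - fine (law X A)| <= t.
  by move=> mA; rewrite distrC; exact: tv.
have XY := mean_tv_le X Y g t bg g01 tv.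
have YX := mean_tv_le Y X g t bg g01 tv'.
have B2 : 0 < 2 * B by rewrite mulr_gt0.
have -> : mean X f - mean Y f = 2 * B * (mean X g - mean Y g).
  by rewrite !gE; ring.
rewrite normrM gtr0_norm// ler_pM2l// ler_distl; apply/andP; split; lra.
Qed.

(** The convergence hypothesis in the form used by [mean_tv_dist]; eventually
    the distance is finite, so that real parts may be compared. *)
Lemma tv_distance_cvg {R : realType} {n : nat} (X_ : nat -> dart R n)
    (X : dart R n) (e : R) : cvg_in_total_variation X_ X -> 0 < e ->
  \forall j \near \oo, forall A, measurable A ->
    `|fine (law (X_ j) A) - fine (law X A)| <= e.
Proof.
move=> tvX e0; have /fine_cvgP[tv_fin tv0] := tvX.
have /cvgrPdist_le/(_ e e0) tve := tv0.
near=> j => A mA; rewrite -lee_fin.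
have tvfin : tv_distance (X_ j) X \is a fin_num by near: j.
have tvj : fine (tv_distance (X_ j) X) <= e.
  rewrite -[leLHS]subr0 -[leLHS]opprB; apply: le_trans (ler_norm _) _.
  by rewrite normrN; near: j.
apply: (@le_trans _ _ (tv_distance (X_ j) X)); last first.
  by rewrite -(fineK tvfin) lee_fin.
apply: ereal_sup_ubound; exists A => //.
rewrite -[law (X_ j) A]fineK ?fin_num_measure//.
by rewrite -[law X A]fineK ?fin_num_measure//.
Unshelve. all: by end_near. Qed.

(** * Payoffs vanishing at infinity *)

(** A continuous bump, equal to 1 on the ball of radius k and to 0 outside the
    ball of radius k + 1. *)
Definition cutoff {R : realType} {n : nat} (k : nat) (x : 'rV[R]_n) : R :=
  Num.max 0 (Num.min 1 (k%:R + 1 - `|x|)).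

Lemma cutoff_itv {R : realType} {n : nat} k (x : 'rV[R]_n) :
  0 <= cutoff k x <= 1.
Proof. by rewrite /cutoff le_max lexx/= ge_max ler01 ge_min lexx. Qed.

Lemma cutoff1 {R : realType} {n : nat} k (x : 'rV[R]_n) :
  `|x| <= k%:R -> cutoff k x = 1.
Proof.
move=> xk; rewrite /cutoff min_l; first by rewrite max_r.
by rewrite addrAC lerDr subr_ge0.
Qed.

Lemma cutoff0 {R : realType} {n : nat} k (x : 'rV[R]_n) :
  k%:R + 1 <= `|x| -> cutoff k x = 0.
Proof.
by move=> kx; rewrite /cutoff max_l// ge_min subr_le0 kx orbT.
Qed.

Lemma Cb_cutoff {R : realType} {n : nat} k : Cb R n (cutoff k).
Proof.
split; last first.
  by exists 1 => x; have /andP[c0 c1] := cutoff_itv k x; rewrite ger0_norm.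
move=> x; apply: (@continuous_max R _ (fun=> 0)
  (fun y : 'rV[R]_n => Num.min 1 (k%:R + 1 - `|y|)) x).
  exact: cst_continuous.
apply: (@continuous_min R _ (fun=> 1) (fun y : 'rV[R]_n => k%:R + 1 - `|y|) x).
  exact: cst_continuous.
apply: (@continuousB _ R^o _ (fun=> k%:R + 1) (fun y : 'rV[R]_n => `|y|) x).
  exact: cst_continuous.
exact: norm_continuous.
Qed.

Lemma C0_cutoffM {R : realType} {n : nat} (f : 'rV[R]_n -> R) k :
  Cb R n f -> C0 R n (fun x => f x * cutoff k x).
Proof.
move=> [cf _]; have [cc _] := @Cb_cutoff R n k; split.
  by move=> x; apply: continuousM; [exact: cf | exact: cc].
move=> e e0; exists (k%:R + 1) => x kx.
by rewrite cutoff0 ?ltW// mulr0 normr0.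
Qed.

Lemma cutoff_cvg {R : realType} {n : nat} (f : 'rV[R]_n -> R) x :
  f x * cutoff k x @[k --> \oo] --> f x.
Proof.
apply: cvg_near_cst; near=> k; rewrite cutoff1 ?mulr1//.
by near: k; exact: nbhs_infty_ger.
Unshelve. all: by end_near. Qed.

Lemma compact_norm_le {R : realType} {n : nat} (M : R) :
  compact [set x : 'rV[R]_n | `|x| <= M].
Proof.
apply: bounded_closed_compact.
  exists M; split; first exact: num_real.
  by move=> y My x /= xM; exact: le_trans xM (ltW My).
apply: (@closed_comp _ _ (fun x : 'rV[R]_n => `|x|) [set r | r <= M]);
  last exact: closed_le.
by move=> x _; exact: norm_continuous.
Qed.

(** Compactness bounds f on a ball outside of which |f| < 1. *)
Lemma C0_Cb {R : realType} {n : nat} (f : 'rV[R]_n -> R) : C0 R n f -> Cb R n f.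
Proof.
move=> [cf f0]; split=> //; have [M fM] := f0 1 ltr01.
have : \forall B \near +oo,
    [set x : 'rV[R]_n | `|x| <= M] `<=` (fun x => `|f x| <= B).
  have /compact_near_coveringP := compact_norm_le M (n := n).
  apply => x _.
  exists ([set y | `|f x - f y| < 1], [set B | `|f x| + 1 <= B]) => /=.
    split; last exact: nbhs_pinfty_ge.
    by have /cvgrPdist_lt/(_ 1 ltr01) := cf x.
  move=> [y B] /= [xy xB]; apply: le_trans xB.
  by rewrite -lerBlDl (le_trans (lerB_dist _ _))// distrC ltW.
move=> nearB; near +oo_R => B.
exists B => x; have [xM|Mx] := leP `|x| M.
  by move: x xM; near: B.
apply: le_trans (ltW (fM _ Mx)) _.
by near: B; exact: nbhs_pinfty_ge.
Unshelve. all: by end_near. Qed.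

(** Heine's argument on a ball of radius M + 1, outside of which f is small.
    The extra unit of radius keeps two close points from straddling the region
    where |f| is not controlled: if the first is outside, the second is at
    distance more than M. *)
Lemma C0_unif_continuous {R : realType} {n : nat} (f : 'rV[R]_n -> R) (e : R) :
  C0 R n f -> 0 < e ->
  \forall r \near 0^'+, forall x y, `|x - y| < r -> `|f x - f y| <= e.
Proof.
move=> [cf f0] e0; have e20 : 0 < e / 2 by rewrite divr_gt0.
have [M fM] := f0 _ e20.
have : \forall r \near 0^'+, [set x : 'rV[R]_n | `|x| <= M + 1] `<=`
    (fun x => forall y, `|x - y| < r -> `|f x - f y| <= e).
  have /compact_near_coveringP := compact_norm_le (M + 1) (n := n).
  apply => x _.
  have cfx : \forall y \near x, `|f x - f y| < e / 2.
    by have /cvgrPdist_lt/(_ _ e20) := cf x.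
  have [r /= r0 xr] := (nbhs_normP x (fun y => `|f x - f y| < e / 2)).1 cfx.
  exists ([set y | `|x - y| < r / 2], [set s | s < r / 2]) => /=.
    split; last by apply: nbhs_right_lt; rewrite divr_gt0.
    by apply/(nbhs_normP x); exists (r / 2); rewrite /= ?divr_gt0.
  move=> [y s] /= [xy sr] z yz.
  have xz : `|x - z| < r.
    rewrite (splitr r) (le_lt_trans (ler_distD y _ _))// ltrD//.
    exact: lt_trans sr.
  have xy' : `|x - y| < r.
    by rewrite (lt_trans xy)// ltr_pdivrMr// ltr_pMr// ltr1n.
  rewrite (splitr e) (le_trans (ler_distD (f x) _ _))// lerD//;
    last exact/ltW/xr.
  by rewrite distrC; exact/ltW/xr.
move=> nearr; near=> r => x y xy; have [xM|Mx] := leP `|x| (M + 1).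
  by move: x xM y xy; near: r.
have r1 : r < 1 by near: r; exact: nbhs_right_lt.
have My : M < `|y|.
  have := lerB_dist x y; lra.
rewrite (splitr e) (le_trans (ler_normB _ _))// lerD// ltW// fM//.
by rewrite (lt_trans _ Mx)// ltrDl.
Unshelve. all: by end_near. Qed.

Lemma mean_cvg {R : realType} {n : nat} (X_ : nat -> dart R n)
    (X : dart R n) h :
  cvg_in_distribution X_ X -> Cb R n h ->
  mean (X_ j) h @[j --> \oo] --> mean X h.
Proof.
move=> XX hCb; have := XX h hCb; have bh := Cb_bounded_borel _ hCb.
rewrite expectationE//; under eq_fun do rewrite expectationE//.
by move/fine_cvg.
Qed.

(** Equicontinuity in the aiming point, uniformly over all darts, because
    moving a translates every landing point by the same vector. *)
Lemma mean_throw_shift {R : realType} {n : nat} (X : dart R n) f (d e r : R)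
    a b :
  Cb R n f -> (forall x y, `|x - y| < r -> `|f x - f y| <= e) -> `|a - b| < r ->
  `|mean X (throw f d a) - mean X (throw f d b)| <= e.
Proof.
move=> fCb fr ab; apply: mean_dist; [exact: bounded_borel_throw..|].
by move=> x; apply: fr; rewrite opprD addrACA subrr addr0.
Qed.

(** With x in the ball of radius k + 1 and a this far away, a + dx lies where f
    is below e; outside that ball only the bound B is available, but this costs
    at most the mass that the cutoff misses. Both cases are covered by the
    pointwise bound |f(a + dx)| <= e + B (1 - cutoff k x). *)
Lemma mean_throw_far {R : realType} {n : nat} (X : dart R n) f
    (d e B M : R) k a :
  Cb R n f -> 0 < d -> 0 <= e -> (forall x, `|f x| <= B) ->
  (forall x, M < `|x| -> `|f x| < e) -> M + d * (k%:R + 1) < `|a| ->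
  `|mean X (throw f d a)| <= e + B * (1 - mean X (cutoff k)).
Proof.
move=> fCb d0 e0 fB fM aM.
have B0 : 0 <= B by exact: le_trans (normr_ge0 _) (fB 0).
have bc : bounded_borel (cutoff k : 'rV[R]_n -> R).
  exact/Cb_bounded_borel/Cb_cutoff.
pose g (x : 'rV[R]_n) := (e + B) + (- B) * cutoff k x.
have bg : bounded_borel g.
  by apply: bounded_borelD; [exact: bounded_borel_cst | exact: bounded_borelZ].
have fg x : `|throw f d a x| <= g x.
  have /andP[c0 c1] := cutoff_itv k x.
  rewrite /throw /g; have [kx|xk] := leP (k%:R + 1) `|x|.
    by rewrite cutoff0// mulr0 addr0 (le_trans (fB _))// lerDr.
  apply: (@le_trans _ _ e); last first.
    by rewrite -addrA lerDl mulNr subr_ge0 ler_piMr.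
  apply/ltW/fM; apply: lt_le_trans (lerB_normD _ _).
  rewrite normrZ gtr0_norm// ltrBrDr (le_lt_trans _ aM)// lerD2l.
  by rewrite ler_pM2l// ltW.
have meang : mean X g = e + B * (1 - mean X (cutoff k)).
  rewrite meanD; [|exact: bounded_borel_cst|exact: bounded_borelZ].
  by rewrite mean_cst meanZ//; ring.
have bf := bounded_borel_throw f d a fCb.
rewrite -meang ler_norml lerNl -mulN1r -meanZ//; apply/andP; split.
  apply: mean_le => //; first exact: bounded_borelZ.
  by move=> x; rewrite mulN1r (le_trans _ (fg x))// -normrN ler_norm.
by apply: mean_le => // x; exact: le_trans (ler_norm _) (fg x).
Qed.

(** A single law is tight. *)
Lemma mean_cutoff_gt {R : realType} {n : nat} (X : dart R n) (e : R) : 0 < e ->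
  exists k, 1 - e < mean X (cutoff k).
Proof.
move=> e0.
have : mean X (cutoff k) @[k --> \oo] --> mean X (fun=> 1).
  apply: (@mean_bounded_cvg _ _ _ _ _ 1).
  - by move=> k; exact/Cb_bounded_borel/Cb_cutoff.
  - exact: bounded_borel_cst.
  - by move=> k x; have /andP[c0 c1] := cutoff_itv k x; rewrite ger0_norm.
  - move=> x; have := cutoff_cvg (fun=> 1) x.
    by under eq_fun do rewrite mul1r.
rewrite mean_cst => /cvgrPdist_lt/(_ e e0) [k _ /(_ k (leqnn k))/= ke].
by exists k; rewrite ltrBlDr -ltrBlDl (le_lt_trans (ler_norm _) ke).
Qed.

(** Tightness of the limit is transferred to X_j by testing weak convergence
    against one cutoff; this disposes of the aiming points beyond radius r.
    Within radius r, equicontinuity and compactness upgrade pointwise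
    convergence to uniform convergence. *)
Lemma C0_mean_unif_cvg {R : realType} {n : nat} (X_ : nat -> dart R n)
    (X : dart R n) f (d : R) : cvg_in_distribution X_ X -> C0 R n f -> 0 < d ->
  forall e, 0 < e -> \forall j \near \oo, forall a,
     `|mean X (throw f d a) - mean (X_ j) (throw f d a)| <= e.
Proof.
move=> XX fC0 d0 e e0; have fCb := C0_Cb f fC0.
have [B B0 fB] := Cb_bound f fCb.
have e40 : 0 < e / 4 by rewrite divr_gt0.
have [M fM] := fC0.2 _ e40.
(* This makes e / 4 + B * eta equal to e / 2. *)
pose eta := e / (4 * B); have eta0 : 0 < eta by rewrite divr_gt0// mulr_gt0.
have [k Xk] := mean_cutoff_gt X eta eta0.
pose r := M + d * (k%:R + 1).
have far (Z : dart R n) a : 1 - eta < mean Z (cutoff k) -> r < `|a| ->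
    `|mean Z (throw f d a)| <= e / 2.
  move=> Zk ra.
  have fZ := mean_throw_far Z f d _ B M k a fCb d0 (ltW e40) fB fM ra.
  apply: le_trans fZ _.
  have -> : e / 2 = e / 4 + B * eta by rewrite /eta; field; lra.
  by rewrite lerD2l ler_pM2l// lerBlDl -lerBlDr ltW.
have XjK : \forall j \near \oo, 1 - eta < mean (X_ j) (cutoff k).
  apply: (cvgr_gt (mean X (cutoff k))) => //.
  by apply: mean_cvg => //; exact: Cb_cutoff.
have e30 : 0 < e / 3 by rewrite divr_gt0.
have nearj : \forall j \near \oo, [set a : 'rV[R]_n | `|a| <= r] `<=`
    (fun a => `|mean X (throw f d a) - mean (X_ j) (throw f d a)| <= e).
  have /compact_near_coveringP := compact_norm_le r (n := n).
  apply => a _.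
  near (0 : R)^'+ => s.
  have s0 : 0 < s by near: s; exact: nbhs_right_gt.
  have fs x y : `|x - y| < s -> `|f x - f y| <= e / 3.
    by move: x y; near: s; exact: C0_unif_continuous.
  exists ([set b | `|a - b| < s],
    [set j | `|mean X (throw f d a) - mean (X_ j) (throw f d a)| <= e / 3])
    => /=.
    split; first by apply/(nbhs_normP a); exists s.
    have /cvgrPdist_le := mean_cvg X_ X _ XX (Cb_throw f d a fCb); exact.
  move=> [b j] /= [ab aj].
  have hX := mean_throw_shift X f d _ _ a b fCb fs ab.
  have hj := mean_throw_shift (X_ j) f d _ _ a b fCb fs ab.
  move: hX hj aj; rewrite !ler_norml => /andP[? ?] /andP[? ?] /andP[? ?].
  apply/andP; split; lra.
near=> j => a; have [ar|ra] := leP `|a| r.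
  by move: a ar; near: j.
rewrite (splitr e) (le_trans (ler_normB _ _))// lerD//; apply: far => //.
by near: j.
Unshelve. all: by end_near. Qed.

(** Each h k = (f + B) * cutoff k vanishes at infinity, so X is reasonable for
    it. Since h k increases to f + B, its gain at d1 is at most that of f + B,
    while its expectation at any fixed aiming point tends to that of f + B at
    d2; thus the comparison of gains passes to f + B, hence to f. *)
Lemma Cb_reasonable_lim {R : realType} {n : nat} (X_ : nat -> dart R n)
    (X : dart R n) : cvg_in_distribution X_ X ->
  (forall j, reasonable_wrt (X_ j) (Cb R n)) -> reasonable_wrt X (Cb R n).
Proof.
move=> XX rX f fCb; apply/(reasonableE X f fCb) => d1 d2 d10 d12.
have d20 := lt_le_trans d10 d12.
have [cf [B fB]] := fCb.
pose g x := f x + B.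
have g0 x : 0 <= g x by have := fB x; rewrite ler_norml /g => /andP[? _]; lra.
have gCb : Cb R n g.
  split; last first.
    by exists (B + B) => x; rewrite ger0_norm// lerD2r (le_trans (ler_norm _)).
  by move=> x; apply: continuousD; [exact: cf | exact: cst_continuous].
pose h k x := g x * cutoff k x.
have hC0 k : C0 R n (h k) by exact: C0_cutoffM.
have hg k x : h k x <= g x.
  by have /andP[c0 c1] := cutoff_itv k x; rewrite /h ler_piMr.
have rh k : rgain X (h k) d2 <= rgain X (h k) d1.
  have hCb := C0_Cb _ (hC0 k).
  apply: (reasonableE X (h k) hCb).1 => //.
  apply: (reasonable_lim X_) => [d d0|j]; last exact: rX.
  by apply: gain_cvg => //; exact: C0_mean_unif_cvg.
have mean_g (d : R) a : mean X (throw g d a) = mean X (throw f d a) + B.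
  rewrite -(mean_cst X B) -meanD; [by []|exact: bounded_borel_throw|].
  exact: bounded_borel_cst.
apply: rgain_le => a; rewrite -(lerD2r B) -mean_g.
have hcvg : mean X (throw (h k) d2 a) @[k --> \oo] --> mean X (throw g d2 a).
  apply: (@mean_bounded_cvg _ _ _ _ _ (B + B)).
  - by move=> k; exact/bounded_borel_throw/C0_Cb.
  - exact: bounded_borel_throw.
  - move=> k x; have /andP[c0 c1] := cutoff_itv k (a + d2 *: x).
    rewrite ger0_norm ?mulr_ge0// (le_trans (hg _ _))// lerD2r.
    exact: le_trans (ler_norm _) (fB _).
  - by move=> x; exact: cutoff_cvg.
apply: (cvgr_to_le hcvg); apply: nearW => k.
apply: le_trans (mean_le_rgain X _ _ _ (C0_Cb _ (hC0 k))) _.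
apply: le_trans (rh k) _; apply: rgain_le => b.
apply: le_trans (_ : mean X (throw g d1 b) <= _).
  by apply: mean_le => [||x]; [exact/bounded_borel_throw/C0_Cb|
    exact: bounded_borel_throw|exact: hg].
by rewrite mean_g lerD2r; exact: mean_le_rgain.
Qed.

(** * A bounded continuous payoff with discontinuous gain *)

Definition two_point_rv {R : realType} {n : nat} (v : 'rV[R]_n) (b : bool) :
  'rV[R]_n := if b then v else 0.

Lemma measurable_two_point_rv {R : realType} {n : nat} (v : 'rV[R]_n) :
  measurable_fun [set: bool] (two_point_rv v).
Proof. by []. Qed.

HB.instance Definition _ {R : realType} {n : nat} (v : 'rV[R]_n) :=
  isMeasurableFun.Build _ _ bool 'rV[R]_n (two_point_rv v)
    (measurable_two_point_rv v).

Definition two_point {R : realType} {n : nat} (v : 'rV[R]_n) : dart R n :=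
  @Dart R n _ bool (bernoulli_prob 2^-1) (two_point_rv v).

(** The integral against a Bernoulli law is first computed for nonnegative
    integrands; adding the bound B of h reduces to that case. *)
Lemma mean_two_point {R : realType} {n : nat} (v : 'rV[R]_n) h :
  bounded_borel h -> mean (two_point v) h = (h v + h 0) / 2.
Proof.
move=> bh; have [_ [B hB]] := bh.
have half01 : 0 <= (2^-1 : R) <= 1 by lra.
have mean_ge0 (g : 'rV[R]_n -> R) : (forall x, 0 <= g x) ->
    mean (two_point v) g = (g v + g 0) / 2.
  move=> g0; rewrite /mean /Rintegral.
  rewrite [X in fine X](integral_bernoulli_prob half01).
    rewrite -!EFinM -EFinD/=.
    by transitivity (2^-1 * g v + (1 - 2^-1) * g 0); [|field].
  by move=> b; rewrite lee_fin.
have := mean_ge0 (fun x => h x + B).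
rewrite meanD ?mean_cst//; last exact: bounded_borel_cst.
have hB0 x : 0 <= h x + B by have := hB x; rewrite ler_norml => /andP[? _]; lra.
move=> /(_ hB0) E; lra.
Qed.

Lemma two_point_cvg {R : realType} {n : nat} (v_ : nat -> 'rV[R]_n) v :
  v_ j @[j --> \oo] --> v ->
  cvg_in_distribution (fun j => two_point (v_ j)) (two_point v).
Proof.
move=> vv h hCb; have bh := Cb_bounded_borel h hCb.
rewrite expectationE//; under eq_fun do rewrite expectationE//.
apply: cvg_EFin; first exact: nearW.
rewrite mean_two_point//.
under eq_fun do rewrite /= mean_two_point//.
apply: cvgM; last exact: cvg_cst.
apply: cvgD; last exact: cvg_cst.
by apply: cvg_comp vv _; exact: hCb.1.
Qed.

(** The frequency grows linearly with t, so that far away a tiny shift changes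
    the phase by a half-turn. *)
Definition chirp {R : realType} (t : R) : R := cos (pi * t ^+ 2).

(** A difference, so that the sum of the values at a and a + 1 telescopes. *)
Definition chirp_payoff {R : realType} {n : nat} (i : 'I_n) (x : 'rV[R]_n) :
  R :=
  chirp (x 0 i) - chirp (x 0 i + 1).

Lemma Cb_chirp_payoff {R : realType} {n : nat} (i : 'I_n) :
  Cb R n (chirp_payoff i).
Proof.
have cc : continuous (@chirp R).
  move=> t; apply: continuous_comp; last exact: continuous_cos.
  by apply: continuousM; [exact: cst_continuous | exact: exprn_continuous].
have ci : continuous (fun x : 'rV[R]_n => x 0 i) by exact: coord_continuous.
split=> [x|].
  apply: (@continuousB _ R^o _ (fun y : 'rV[R]_n => chirp (y 0 i))
    (fun y => chirp (y 0 i + 1)) x).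
    by apply: (@continuous_comp _ _ _ _ (@chirp R)); [exact: ci | exact: cc].
  apply: (@continuous_comp _ _ _ (fun y : 'rV[R]_n => y 0 i + 1) (@chirp R));
    last exact: cc.
  by apply: (@continuousD _ R^o _ (fun y : 'rV[R]_n => y 0 i) (fun=> 1));
    [exact: ci | exact: cst_continuous].
exists 2 => x; rewrite (le_trans (ler_normB _ _))// (_ : 2 = 1 + 1)//.
by rewrite lerD// ler_norml cos_geN1 cos_le1.
Qed.

(** Adding pi to the phase changes the sign of the cosine, so an integer summand
    of t^2 only matters through its parity. *)
Lemma chirpD {R : realType} (t r : R) k :
  t ^+ 2 = r + k%:R -> chirp t = (- 1) ^+ odd k * cos (pi * r).
Proof.
move=> tE; rewrite signr_odd /chirp tE mulrDr mulr_natr.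
elim: k {tE} => [|k IH]; rewrite ?addr0 ?mul1r//.
by rewrite mulrS (addrC pi) addrA cosDpi IH exprS mulN1r mulNr.
Qed.

Lemma mean_chirp {R : realType} {n : nat} (i : 'I_n) (t : R) a :
  mean (two_point (t *: const_mx 1)) (throw (chirp_payoff i) 1 a) =
  (chirp (a 0 i + t) - chirp (a 0 i + t + 1)
   + chirp (a 0 i) - chirp (a 0 i + 1)) / 2.
Proof.
rewrite mean_two_point; last exact/bounded_borel_throw/Cb_chirp_payoff.
by rewrite /throw /chirp_payoff !scale1r addr0 !mxE mulr1 -!addrA.
Qed.

(** For even m the phases m^2 and (m + 1)^2, in half-turns, contribute 1 each.
    The choice of s is such that 2 s (m + 1) = 1: the shift adds one half-turn,
    up to s^2 or 2 s + s^2, to the phases (m + 1)^2 and (m + 2)^2, which flips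
    their signs and makes these two terms nonnegative as well. *)
Lemma resonance_le {R : realType} (m : nat) (s : R) :
  ~~ odd m -> (2 <= m)%N -> s = (2 * m.+1%:R)^-1 ->
  2 + cos (pi * (2 / 5)) <=
  chirp (m%:R + (1 + s)) - chirp (m%:R + (1 + s) + 1)
  + chirp m%:R - chirp (m%:R + 1).
Proof.
move=> m_even m2 sE; set a : R := m%:R.
have a2 : 2 <= a by rewrite ler_nat.
have a1E : m.+1%:R = a + 1 by rewrite natr1.
have a2E : m.+2%:R = a + 1 + 1 by rewrite -a1E natr1.
have s_gap : s * (2 * (a + 1)) = 1.
  by rewrite sE a1E mulVf// mulf_neq0// gt_eqF//; lra.
have s0 : 0 < s by rewrite sE invr_gt0 mulr_gt0.
(* Then 2 s + s^2 <= 13/36 < 2/5 < 1/2, which keeps the cosines positive. *)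
have s6 : s <= 6^-1 by nra.
have h1 : (a + (1 + s)) ^+ 2 = s ^+ 2 + (m.+1 ^ 2).+1%:R.
  by rewrite -[(_ ^ _).+1%:R]natr1 natrX a1E -[X in _ = _ + (_ + X)]s_gap; ring.
have h2 : (a + (1 + s) + 1) ^+ 2 = (2 * s + s ^+ 2) + (m.+2 ^ 2).+1%:R.
  by rewrite -[(_ ^ _).+1%:R]natr1 natrX a2E -[X in _ = _ + (_ + X)]s_gap; ring.
have h3 : a ^+ 2 = 0 + (m ^ 2)%:R by rewrite natrX add0r.
have h4 : (a + 1) ^+ 2 = 0 + (m.+1 ^ 2)%:R by rewrite natrX a1E add0r.
rewrite (chirpD _ _ _ h1) (chirpD _ _ _ h2) (chirpD _ _ _ h3) (chirpD _ _ _ h4).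
rewrite !(oddS, oddX) (negbTE m_even) orbF orFb mulr0 cos0 !expr0 !expr1.
have pi0 := pi_gt0 R.
have q0 : 0 <= s ^+ 2 by exact: sqr_ge0.
have q1 : s ^+ 2 <= 36^-1 by nra.
have pi_mul (r r' : R) : r <= r' -> pi * r <= pi * r'.
  by move=> rr'; rewrite ler_pM2l.
have c1 : 0 <= cos (pi * s ^+ 2).
  apply: cos_ge0_pihalf; apply/andP; split.
    have p0 : 0 <= pi * s ^+ 2 by rewrite mulr_ge0// ltW.
    by apply: le_trans p0; rewrite oppr_le0 divr_ge0// ltW.
  by apply: pi_mul; lra.
have c2 : cos (pi * (2 / 5)) <= cos (pi * (2 * s + s ^+ 2)).
  have itv (r : R) : 0 <= r <= 1 -> pi * r \in `[0, pi].
    move=> /andP[r0 r1]; rewrite in_itv/= mulr_ge0 ?(ltW pi0)//=.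
    by rewrite -[leRHS]mulr1; exact: pi_mul.
  by rewrite ltW// ltr_cos; [rewrite ltr_pM2l//|apply: itv|apply: itv]; lra.
lra.
Qed.

(** The shift of [resonance_le] for the aiming point m = 2 (j + 1). *)
Definition resonant_shift {R : realType} (j : nat) : R :=
  (2 * (j.+1).*2.+1%:R)^-1.

Lemma resonant_shift_cvg {R : realType} :
  @resonant_shift R j @[j --> \oo] --> (0 : R).
Proof.
apply: (@squeeze_cvgr _ _ _ _ (fun=> 0) (@harmonic R)); last 2 first.
- exact: cvg_cst.
- exact: cvg_harmonic.
apply: nearW => j; rewrite /resonant_shift invr_ge0 mulr_ge0//=.
rewrite /harmonic/= lef_pV2 ?posrE ?mulr_gt0// -natrM ler_nat.
by rewrite (leq_trans _ (leq_pmull _ _))// leqW// -addnn leq_addr.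
Qed.

Lemma gain_not_cvg {R : realType} {n : nat} : (0 < n)%N ->
  exists (X_ : nat -> dart R n) (X : dart R n), cvg_in_distribution X_ X /\
    exists f, Cb R n f /\ exists d : R, 0 < d /\
      ~ (gain (X_ j) f d @[j --> \oo] --> gain X f d).
Proof.
move=> n0; pose i := Ordinal n0; pose e : 'rV[R]_n := const_mx 1.
exists (fun j => two_point ((1 + resonant_shift j) *: e)), (two_point (1 *: e)).
split.
  apply: two_point_cvg; apply: cvgZ; last exact: cvg_cst.
  rewrite -[X in _ --> X]addr0; apply: cvgD; first exact: cvg_cst.
  exact: resonant_shift_cvg.
have fCb := @Cb_chirp_payoff R n i.
exists (chirp_payoff i); split => //; exists 1; split => // gg.
pose c : R := cos (pi * (2 / 5)).
have c0 : 0 < c.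
  by have pi0 := pi_gt0 R; apply: cos_gt0_pihalf; apply/andP; split; nra.
have gX : (gain (two_point (1 *: e)) (chirp_payoff i) 1 <= 1%:E)%E.
  rewrite gainE// lee_fin; apply: rgain_le => a; rewrite mean_chirp.
  (* The inner two terms cancel; the outer two are at most 1 each. *)
  rewrite ler_pdivrMr// mul1r.
  have := cos_le1 (pi * a 0 i ^+ 2).
  have := cos_geN1 (pi * (a 0 i + 1 + 1) ^+ 2).
  rewrite -!/(chirp _); lra.
have : ((1 + c / 2)%:E <= gain (two_point (1 *: e)) (chirp_payoff i) 1)%E.
  apply: (lee_cvg_to (cvg_cst _) gg); apply: nearW => j.
  rewrite gainE// lee_fin.
  have := mean_le_rgain (two_point ((1 + resonant_shift j) *: e)) _ 1
    (const_mx (j.+1).*2%:R) fCb.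
  apply: le_trans; rewrite mean_chirp mxE.
  rewrite ler_pdivlMr// mulrDl mul1r divfK//.
  by apply: resonance_le; rewrite ?odd_double.
move=> /le_trans/(_ gX); rewrite lee_fin; lra.
Qed.

(** * The limit theorem *)

Theorem theorem1p21 (R : realType) (n : nat) (n_gt0 : (0 < n)%N) :
  (forall (X_ : nat -> dart R n) (X : dart R n), cvg_in_distribution X_ X ->
     (forall f, C0 R n f -> forall d : R, 0 < d ->
        gain (X_ j) f d @[j --> \oo] --> gain X f d) /\
     (forall f, C0 R n f -> (forall j, reasonable (X_ j) f) ->
        reasonable X f)) /\
  (exists (X_ : nat -> dart R n) (X : dart R n),
     cvg_in_distribution X_ X /\
     exists f, Cb R n f /\ exists d : R, 0 < d /\
       ~ (gain (X_ j) f d @[j --> \oo] --> gain X f d)) /\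
  (forall (X_ : nat -> dart R n) (X : dart R n), cvg_in_distribution X_ X ->
     cvg_in_total_variation X_ X ->
     (forall f, Cb R n f -> forall d : R, 0 < d ->
        gain (X_ j) f d @[j --> \oo] --> gain X f d) /\
     (forall f, Cb R n f -> (forall j, reasonable (X_ j) f) ->
        reasonable X f)) /\
  (forall (X_ : nat -> dart R n) (X : dart R n), cvg_in_distribution X_ X ->
     (forall j, reasonable_wrt (X_ j) (Cb R n)) ->
     reasonable_wrt X (Cb R n)).
Proof.
split; last split; last split.
- move=> X_ X XX.
  have C0_gain f : C0 R n f -> forall d : R, 0 < d ->
      gain (X_ j) f d @[j --> \oo] --> gain X f d.
    move=> fC0 d d0; apply: gain_cvg; first exact: C0_Cb.
    exact: C0_mean_unif_cvg.
  by split=> // f fC0; apply: reasonable_lim; exact: C0_gain.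
- exact: gain_not_cvg.
- move=> X_ X _ tvX.
  have Cb_gain f : Cb R n f -> forall d : R, 0 < d ->
      gain (X_ j) f d @[j --> \oo] --> gain X f d.
    move=> fCb d _; apply: gain_cvg => // e e0.
    have [B B0 fB] := Cb_bound f fCb.
    have B2 : 0 < 2 * B by rewrite mulr_gt0.
    have := tv_distance_cvg X_ X _ tvX (divr_gt0 e0 B2).
    apply: filterS => j tvj a; rewrite distrC -[e](divfK (lt0r_neq0 B2)) mulrC.
    apply: mean_tv_dist => //; first exact: bounded_borel_throw.
    by move=> x; exact: fB.
  by split=> // f fCb; apply: reasonable_lim; exact: Cb_gain.
- by move=> X_ X XX rX; exact: Cb_reasonable_lim rX.
Qed.
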